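(* Let $G$ be a connected subcubic graph (simple, maximum degree at most $3$) with at least two vertices. Then $G$ is decomposable unless $G$ is isomorphic to one of the following eight graphs: (1) $K_3$; (2) $K_4$; (3) $K_{3,3}$; (4) $K_4-e$ (the graph obtained from $K_4$ by deleting one edge); (5) $K_{2,3}$; (6) the graph obtained from $K_4$ by subdividing exactly one edge once; (7) the graph obtained from $K_4$ by subdividing once each of two disjoint edges; (8) the graph obtained from $K_{3,3}$ by subdividing exactly one edge once. None of these eight graphs is decomposable.
   Context: All graphs are finite and simple. A graph is subcubic if every vertex has degree at most $3$. A matching $M$ of a graph $G$ is called separating if $G-M$ has more connected components than $G$. A matching cut of $G$ is a matching $M$ that is an edge cut, i.e. $M$ is the set of all edges between $X$ and $V(G)\setminus X$ for some nonempty proper subset $X\subseteq V(G)$. A graph is decomposable if it has a matching cut (equivalently, a separating matching). Subdividing an edge $xy$ once means replacing it by a path $x\,w\,y$ through a new vertex $w$. *)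

(* Defs.v *)
From mathcomp Require Import all_boot.
Set Implicit Arguments.
Unset Strict Implicit.
Unset Printing Implicit Defensive.

Record sgraph := SGraph {
  vertex :> finType;
  adj : rel vertex;
  adj_sym : symmetric adj;
  adj_irrefl : irreflexive adj }.

Notation "x -- y" := (adj x y) (at level 30).

Section Notions.
Variable G : sgraph.

Definition edges : {set {set G}} :=
  [set E | [exists x, exists y, (x -- y) && (E == [set x; y])]].

Definition degree (x : G) : nat := #|[set y | x -- y]|.

Definition subcubic : Prop := forall x : G, degree x <= 3.

Definition connected : Prop := forall x y : G, connect (@adj G) x y.

Definition matching (M : {set {set G}}) : Prop :=
  M \subset edges /\ trivIset M.

Definition edges_across (X : {set G}) : {set {set G}} :=
  [set E in edges | [exists x in X, exists y in ~: X, E == [set x; y]]].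

Definition edge_cut (M : {set {set G}}) : Prop :=
  exists X : {set G}, [/\ X != set0, X \proper [set: G] & M = edges_across X].

Definition matching_cut (M : {set {set G}}) : Prop :=
  matching M /\ edge_cut M.

Definition decomposable : Prop := exists M, matching_cut M.

End Notions.

Definition isomorphic (G H : sgraph) : Prop :=
  exists2 f : G -> H, bijective f & forall x y, (f x -- f y) = (x -- y).

Definition complete_rel n : rel 'I_n := fun x y => x != y.

Lemma complete_sym n : symmetric (@complete_rel n).
Proof. by move=> x y; rewrite /complete_rel eq_sym. Qed.

Lemma complete_irrefl n : irreflexive (@complete_rel n).
Proof. by move=> x; rewrite /complete_rel eqxx. Qed.

Definition complete n : sgraph :=
  SGraph (@complete_sym n) (@complete_irrefl n).

Definition bipartite_rel m n : rel ('I_m + 'I_n)%type := fun u v =>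
  match u, v with
  | inl _, inr _ | inr _, inl _ => true
  | _, _ => false
  end.

Lemma bipartite_sym m n : symmetric (@bipartite_rel m n).
Proof. by move=> [x|x] [y|y]. Qed.

Lemma bipartite_irrefl m n : irreflexive (@bipartite_rel m n).
Proof. by move=> [x|x]. Qed.

Definition complete_bipartite m n : sgraph :=
  SGraph (@bipartite_sym m n) (@bipartite_irrefl m n).

Section EdgeOperations.
Variables (G : sgraph) (a b : G).

Definition del_rel : rel G :=
  fun x y => (x -- y) && ([set x; y] != [set a; b]).

Lemma del_sym : symmetric del_rel.
Proof. by move=> x y; rewrite /del_rel adj_sym setUC. Qed.

Lemma del_irrefl : irreflexive del_rel.
Proof. by move=> x; rewrite /del_rel adj_irrefl. Qed.

Definition delete_edge : sgraph := SGraph del_sym del_irrefl.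

(* None is the new vertex; this is the subdivision of the edge ab
   only when a -- b. *)
Definition subdiv_rel : rel (option G) := fun u v =>
  match u, v with
  | Some x, Some y => del_rel x y
  | Some x, None | None, Some x => x \in [set a; b]
  | None, None => false
  end.

Lemma subdiv_sym : symmetric subdiv_rel.
Proof. by move=> [x|] [y|] //=; rewrite del_sym. Qed.

Lemma subdiv_irrefl : irreflexive subdiv_rel.
Proof. by move=> [x|] //=; rewrite del_irrefl. Qed.

Definition subdivide : sgraph := SGraph subdiv_sym subdiv_irrefl.

End EdgeOperations.

Notation K3 := (complete 3).
Notation K4 := (complete 4).
Notation K33 := (complete_bipartite 3 3).
Notation K23 := (complete_bipartite 2 3).

Definition v0 : K4 := @Ordinal 4 0 isT.
Definition v1 : K4 := @Ordinal 4 1 isT.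
Definition v2 : K4 := @Ordinal 4 2 isT.
Definition v3 : K4 := @Ordinal 4 3 isT.

Definition K4_minus_edge : sgraph := delete_edge v0 v1.

Definition K4_subdiv1 : sgraph := subdivide v0 v1.

Definition K4_subdiv2 : sgraph := @subdivide K4_subdiv1 (Some v2) (Some v3).

Definition K33_subdiv1 : sgraph :=
  @subdivide K33 (inl ord0) (inr ord0).

Definition exceptional (G : sgraph) : Prop :=
  isomorphic G K3 \/ isomorphic G K4 \/ isomorphic G K33 \/
  isomorphic G K4_minus_edge \/ isomorphic G K23 \/
  isomorphic G K4_subdiv1 \/ isomorphic G K4_subdiv2 \/
  isomorphic G K33_subdiv1.

(* Main.v *)
Require Import Defs.
From mathcomp Require Import all_boot.
Set Implicit Arguments.
Unset Strict Implicit.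
Unset Printing Implicit Defensive.

(** A matching cut amounts to a nonempty proper vertex set [X] such that every
    vertex has at most one neighbour on the other side of [X]. Let [G] be
    indecomposable. Then [G] has minimum degree at least 2, hence a cycle. If
    every vertex of [X] has two neighbours in [X], then it has at most one
    outside, so either [X] is everything or some [w] outside [X] has two
    neighbours in [X], and [w] can be added to [X]. Applied to a shortest cycle
    this produces a shorter one unless the length is 3 or 4. Starting from that
    short cycle one absorbs vertices until all of [G] is reached; since the number
    of edges leaving the set decreases at each step, at most three vertices are
    added, and the finitely many outcomes are examined by computation. *)

(** * Search over adjacency codes *)

Fixpoint bitseqs n : seq bitseq :=
  if n is k.+1 then map (cons true) (bitseqs k) ++ map (cons false) (bitseqs k)
  else [:: [::]].

(** The strictly upper triangular part of the adjacency matrix. A new vertex put in front only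
    prepends one row, so absorption acts on codes by [cons]. *)
Fixpoint tri (T : Type) (e : rel T) (vs : seq T) : seq bitseq :=
  if vs is w :: vs' then [seq e w x | x <- vs'] :: tri e vs' else [::].

Definition mat (T : Type) (e : rel T) (vs : seq T) : seq bitseq :=
  [seq [seq e x y | y <- vs] | x <- vs].

Fixpoint full (c : seq bitseq) : seq bitseq :=
  if c is r :: c' then
    (false :: r) :: [seq p.1 :: p.2 | p <- zip r (full c')]
  else [::].

(* [m] lists, vertex by vertex, the membership in the side [X] of the cut. *)
Definition cut_mask (M : seq bitseq) (m : bitseq) : bool :=
  [&& true \in m, false \in m &
      all (fun p => count (fun q => q.1 && (q.2 != p.1)) (zip p.2 m) <= 1)
          (zip m M)].

Definition has_cut (M : seq bitseq) : bool :=
  has (cut_mask M) (bitseqs (size M)).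

Definition entry (M : seq bitseq) : rel nat :=
  fun i j => nth false (nth [::] M i) j.

(* All injective labellings [f] of the vertices of the code [c] by rows of [M]
   that identify [c] with the graph of adjacency matrix [M]; the vertices are
   labelled from the last one backwards, so that bad choices are pruned early. *)
Fixpoint labellings (M : seq bitseq) (c : seq bitseq) : seq (seq nat) :=
  if c is r :: c' then
    flatten [seq [seq v :: f | v <- iota 0 (size M)
                   & (v \notin f) && ([seq entry M v u | u <- f] == r)]
            | f <- labellings M c']
  else [:: [::]].

Definition matches (c M : seq bitseq) : bool :=
  (size c == size M) && (labellings M c != [::]).

(** The lower bound 2 comes from absorption, the upper bound 3 from subcubicity. *)
Definition extensions (c : seq bitseq) : seq (seq bitseq) :=
  [seq r :: c | r <- bitseqs (size c)
     & (2 <= count id r) && all (fun row => count id row <= 3) (full (r :: c))].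

(* [k] bounds the depth of the search: [closes] fails if [k] steps of absorption
   do not exhaust the extensions of [c]. *)
Fixpoint closes (Ts : seq (seq bitseq)) k (c : seq bitseq) : bool :=
  if k is k'.+1 then
    (has_cut (full c) || has (matches c) Ts) && all (closes Ts k') (extensions c)
  else false.

Definition mat_of (n : nat) (es : seq (nat * nat)) : seq bitseq :=
  mat (fun i j => ((i, j) \in es) || ((j, i) \in es)) (iota 0 n).

(* In the order of the disjuncts of [exceptional]; a subdividing vertex comes
   after the vertices of the original graph. *)
Definition exceptional_mats : seq (seq bitseq) :=
  [:: mat_of 3 [:: (0, 1); (0, 2); (1, 2)];
      mat_of 4 [:: (0, 1); (0, 2); (0, 3); (1, 2); (1, 3); (2, 3)];
      mat_of 6 [:: (0, 3); (0, 4); (0, 5); (1, 3); (1, 4); (1, 5);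
                   (2, 3); (2, 4); (2, 5)];
      mat_of 4 [:: (0, 2); (0, 3); (1, 2); (1, 3); (2, 3)];
      mat_of 5 [:: (0, 2); (0, 3); (0, 4); (1, 2); (1, 3); (1, 4)];
      mat_of 5 [:: (0, 4); (1, 4); (0, 2); (0, 3); (1, 2); (1, 3); (2, 3)];
      mat_of 6 [:: (0, 4); (1, 4); (0, 2); (0, 3); (1, 2); (1, 3);
                   (2, 5); (3, 5)];
      mat_of 7 [:: (0, 6); (3, 6); (0, 4); (0, 5); (1, 3); (1, 4); (1, 5);
                   (2, 3); (2, 4); (2, 5)]].

(* The triangle, and the 4-cycle with its two diagonals present or not. *)
Definition seeds : seq (seq bitseq) :=
  [:: [:: [:: true; true]; [:: true]; [::]]]
  ++ [seq [:: [:: true; b.1; true]; [:: true; b.2]; [:: true]; [::]]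
     | b <- [:: (false, false); (false, true); (true, false); (true, true)]].

(** Every code reached may be all of [G], so each is tested. A seed has at most 4 free degree slots;
    an extension uses at least two and lowers their number, so at most three vertices are added, and
    depth 4 suffices. *)
Lemma seeds_close : all (closes exceptional_mats 4) seeds.
Proof. by vm_compute. Qed.

Lemma exceptional_mats_uncut : ~~ has has_cut exceptional_mats.
Proof. by vm_compute. Qed.

Lemma mem_bitseqs n m : (m \in bitseqs n) = (size m == n).
Proof.
elim: n m => [|n IHn] [|b m]; rewrite ?inE //= mem_cat.
  by apply/negbTE; rewrite negb_or; apply/andP; split; apply/mapP => -[].
have mem_cons b' s : (b :: m \in map (cons b') s) = (b == b') && (m \in s).
  apply/mapP/andP => [[m' sm' [-> ->]]|[/eqP-> sm]]; first by rewrite eqxx.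
  by exists m.
by rewrite !mem_cons !IHn eqSS; case: (b) => /=; rewrite ?orbF.
Qed.

Lemma size_tri (T : Type) (e : rel T) vs : size (tri e vs) = size vs.
Proof. by elim: vs => //= x vs ->. Qed.

Lemma full_tri (T : Type) (e : rel T) vs :
  symmetric e -> irreflexive e -> full (tri e vs) = mat e vs.
Proof.
move=> e_sym e_irr; elim: vs => //= x vs ->; rewrite /mat /= e_irr.
congr (_ :: _); rewrite zip_map -map_comp.
by apply: eq_map => y /=; rewrite e_sym.
Qed.

Lemma entry_mat (T : Type) (e : rel T) x0 vs i j :
    i < size vs -> j < size vs ->
  entry (mat e vs) i j = e (nth x0 vs i) (nth x0 vs j).
Proof.
by move=> lti ltj; rewrite /entry (nth_map x0) // (nth_map x0).
Qed.

Lemma labellings_sound (T : Type) (e : rel T) x0 ws c f :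
    f \in labellings (mat e ws) c ->
  [/\ uniq f, {in f, forall i, i < size ws} &
      tri e [seq nth x0 ws i | i <- f] = c].
Proof.
elim: c f => [|r c IHc] f /=; first by rewrite inE => /eqP->.
case/flatten_mapP => g /IHc[Ug ltg tri_g] /mapP[v].
rewrite mem_filter mem_iota size_map => /andP[/andP[vNg /eqP def_r] /= ltv] ->.
split; first by rewrite /= vNg.
  by move=> i; rewrite inE => /predU1P[->|/ltg].
rewrite /= tri_g -def_r -map_comp; congr (_ :: _); apply/eq_in_map => i /ltg lti.
by rewrite (entry_mat _ x0).
Qed.

(** * Matching cuts as vertex bipartitions *)

Section Graph.
Variable G : sgraph.
Implicit Types (x y z w : G) (X : {set G}) (vs : seq G).

Definition cross X x := [set y | (x -- y) && ((y \in X) != (x \in X))].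

(** Two cut edges that meet in [x] have as other ends two neighbours of [x] across the cut, so
    disjointness of the cut edges is a bound of 1 on every [cross X x]. *)
Lemma decomposableP :
  decomposable G <->
  exists X, [/\ X != set0, X != setT & forall x, #|cross X x| <= 1].
Proof.
split=> [[M [[_ /trivIsetP tiM] [X [X0 XT defM]]]] | [X [X0 XT cX]]].
  exists X; split=> // [|x]; first by rewrite properT in XT.
  have crossM y : y \in cross X x -> [set x; y] \in M.
    rewrite inE defM !inE => /andP[xy yX]; apply/andP; split.
      by apply/existsP; exists x; apply/existsP; exists y; rewrite xy /=.
    case: (boolP (x \in X)) yX => xX yX.
      apply/existsP; exists x; rewrite xX /=.
      by apply/existsP; exists y; rewrite inE eqxx andbT; case: (y \in X) yX.
    apply/existsP; exists y; case: (y \in X) yX => //= _.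
    by apply/existsP; exists x; rewrite inE xX setUC /=.
  apply/card_le1_eqP => y z /[dup] Cy /crossM My /[dup] Cz /crossM Mz.
  apply/eqP/negPn/negP => yz.
  have neq: [set x; y] != [set x; z].
    apply: contra yz => /eqP /setP /(_ y); rewrite !inE eqxx orbT => /esym.
    case/orP=> /eqP yx; last by rewrite yx.
    by move: Cy; rewrite inE yx adj_irrefl.
  have /pred0P /(_ x) := tiM _ _ My Mz neq.
  by rewrite /= !inE eqxx.
exists (edges_across X); split; last by exists X; rewrite properT.
split; first by apply/subsetP => E; rewrite inE => /andP[].
have edgeP E : E \in edges_across X ->
    exists x y, [/\ x \in X, y \notin X, x -- y & E = [set x; y]].
  rewrite !inE => /andP[/existsP[a /existsP[b /andP[ab /eqP Eab]]]].
  case/existsP=> x /andP[xX] /existsP[y]; rewrite inE => /andP[yX /eqP Exy].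
  exists x, y; split=> //.
  have: x \in E by rewrite Exy !inE eqxx.
  have: y \in E by rewrite Exy !inE eqxx orbT.
  rewrite Eab !inE => /orP[] /eqP eqy /orP[] /eqP eqx; subst x y => //.
  - by rewrite xX in yX.
  - by rewrite adj_sym.
  - by rewrite xX in yX.
apply/trivIsetP => E F /edgeP[x [y [xX yX xy ->]]] /edgeP[x' [y' [x'X y'X x'y' ->]]].
apply: contraR; rewrite -setI_eq0 => /set0Pn[z]; rewrite !inE.
(* The common end lies on one side, so it is the [X]-end of both edges or of neither; the bound on
   [cross] then identifies the other ends. *)
case/andP=> /orP[] /eqP-> /orP[] /eqP eqz; subst.
- apply/eqP; congr [set _; _]; apply: (card_le1_eqP (cX x')).
    by rewrite inE ?xy ?x'y' x'X ?(negbTE yX) ?(negbTE y'X).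
  by rewrite inE ?xy ?x'y' x'X ?(negbTE yX) ?(negbTE y'X).
- by rewrite xX in y'X.
- by rewrite x'X in yX.
- apply/eqP; congr [set _; _]; apply: (card_le1_eqP (cX y')).
    by rewrite inE adj_sym ?xy ?x'y' ?xX ?x'X (negbTE yX).
  by rewrite inE adj_sym ?xy ?x'y' ?xX ?x'X (negbTE yX).
Qed.

Lemma cut_mask_mat vs X : uniq vs -> (forall x, x \in vs) ->
  cut_mask (mat (@adj G) vs) [seq x \in X | x <- vs] <->
  [/\ X != set0, X != setT & forall x, #|cross X x| <= 1].
Proof.
move=> Uvs vsT.
have cnt x : count (fun q : bool * bool => q.1 && (q.2 != (x \in X)))
    (zip [seq x -- y | y <- vs] [seq y \in X | y <- vs]) = #|cross X x|.
  rewrite zip_map count_map -size_filter cardE; apply: perm_size.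
  apply: uniq_perm; [exact: filter_uniq | exact: enum_uniq | move=> y].
  by rewrite mem_filter mem_enum vsT andbT [RHS]inE.
have memX b : (b \in [seq x \in X | x <- vs]) = [exists x, (x \in X) == b].
  apply/mapP/existsP => [[x _ ->]|[x /eqP <-]]; by exists x.
rewrite /cut_mask !memX zip_map all_map.
split=> [/and3P[/existsP[x xX] /existsP[y yX] /allP cX]|[X0 XT cX]].
  split; first by apply/set0Pn; exists x; apply/eqP.
    by apply: contraTneq yX => ->; rewrite inE.
  by move=> z; have /= := cX z (vsT z); rewrite cnt.
apply/and3P; split.
- by have /set0Pn[x xX] := X0; apply/existsP; exists x; apply/eqP.
- apply/existsP; move: XT; rewrite -subTset => /subsetPn[x _ xX].
  by exists x; rewrite (negbTE xX).
- by apply/allP => x _ /=; rewrite cnt.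
Qed.

Lemma has_cut_mat vs : uniq vs -> (forall x, x \in vs) ->
  has_cut (mat (@adj G) vs) <-> decomposable G.
Proof.
move=> Uvs vsT; split=> [/hasP[m]|/decomposableP[X cX]].
  rewrite mem_bitseqs size_map => /eqP sz_m cut_m.
  apply/decomposableP; exists [set x | nth false m (index x vs)].
  apply/(cut_mask_mat _ Uvs vsT).
  suff -> : [seq x \in [set x | nth false m (index x vs)] | x <- vs] = m by [].
  apply: (@eq_from_nth _ false) => [|i]; first by rewrite size_map.
  rewrite size_map => lti.
  have x0 : G by case: (vs) lti => [|x ?].
  by rewrite (nth_map x0) // inE index_uniq.
apply/hasP; exists [seq x \in X | x <- vs]; first by rewrite mem_bitseqs !size_map.
exact/(cut_mask_mat _ Uvs vsT).
Qed.

(** * Absorption of vertices *)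

Lemma count_adj x vs : uniq vs -> count (adj x) vs = #|[set y in vs | x -- y]|.
Proof.
move=> Uvs; rewrite -size_filter cardE; apply: perm_size.
apply: uniq_perm; [exact: filter_uniq | exact: enum_uniq | move=> y].
by rewrite mem_filter mem_enum inE andbC.
Qed.

Lemma count_adj_le vs x : subcubic G -> uniq vs -> count (adj x) vs <= 3.
Proof.
move=> G3 Uvs; rewrite count_adj //; apply: leq_trans (G3 x).
by apply/subset_leq_card/subsetP => y; rewrite !inE => /andP[].
Qed.

(* Otherwise [X] itself would be one side of a matching cut. *)
Lemma absorb X : ~ decomposable G -> X != set0 -> X != setT ->
    {in X, forall x, #|cross X x| <= 1} ->
  exists2 w, w \notin X & 1 < #|[set y in X | w -- y]|.
Proof.
move=> indec X0 XT cX.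
have [/existsP[w /andP[wX w2]]|noW] :=
  boolP [exists w, (w \notin X) && (1 < #|[set y in X | w -- y]|)].
  by exists w.
case: indec; apply/decomposableP; exists X; split=> // x.
have [/cX //|xX] := boolP (x \in X).
move: noW; rewrite negb_exists => /forallP/(_ x); rewrite xX /= -leqNgt.
apply: leq_trans; apply/subset_leq_card/subsetP => y.
by rewrite !inE (negbTE xX) => /andP[-> ]; case: (y \in X).
Qed.

(** The invariant of absorption: it holds for a cycle and survives the addition of a vertex with two
    neighbours in the list. *)
Definition inner vs := all (fun x => 2 <= count (adj x) vs) vs.

(** With degree at most 3, two neighbours inside leave at most one outside, so [absorb] applies. *)
Lemma inner_absorb vs : subcubic G -> ~ decomposable G ->
    uniq vs -> vs != [::] -> inner vs -> [exists x, x \notin vs] ->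
  exists2 w, w \notin vs & 2 <= count (adj w) vs.
Proof.
move=> G3 indec Uvs vs0 /allP Ivs /existsP[y yvs].
have [|||w] := @absorb [set x in vs] indec.
- by case: (vs) vs0 => // x s _; apply/set0Pn; exists x; rewrite !inE eqxx.
- by apply: contraNneq yvs => /setP/(_ y); rewrite !inE.
- move=> x; rewrite inE => /[dup] xvs /Ivs; rewrite count_adj // => x2.
  have := G3 x; rewrite /degree -(cardsID [set y in vs]) => x3.
  suff: #|cross [set x in vs] x| <= #|[set y | x -- y] :\: [set y in vs]|.
    move=> le; rewrite -(leq_add2l 2); apply: leq_trans x3.
    apply: leq_add le; apply: leq_trans x2 _; apply/subset_leq_card/subsetP => z.
    by rewrite !inE andbC.
  apply/subset_leq_card/subsetP => z; rewrite !inE xvs.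
  by case/andP=> ->; case: (z \in vs).
rewrite inE => wvs w2; exists w => //; rewrite count_adj //.
apply: leq_trans w2 _; apply/subset_leq_card/subsetP => z; by rewrite !inE.
Qed.

End Graph.

(** * Isomorphism through adjacency codes *)

Lemma tri_isomorphic (G H : sgraph) (vs : seq G) (ws : seq H) :
    vs != [::] -> uniq vs -> uniq ws ->
    (forall x, x \in vs) -> (forall y, y \in ws) ->
    tri (@adj G) vs = tri (@adj H) ws ->
  isomorphic G H.
Proof.
move=> vs0 Uvs Uws vsT wsT eq_tri.
have sz : size vs = size ws.
  by rewrite -(size_tri (@adj G)) eq_tri size_tri.
have eq_mat : mat (@adj G) vs = mat (@adj H) ws.
  rewrite -!full_tri ?eq_tri //; try exact: adj_sym; exact: adj_irrefl.
have [x0 _] : exists x0 : G, x0 \in vs.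
  by case: (vs) vs0 => // x s _; exists x; rewrite inE eqxx.
have [y0 _] : exists y0 : H, y0 \in ws.
  case: (ws) sz => [/size0nil vs_nil|y s _]; last by exists y; rewrite inE eqxx.
  by rewrite vs_nil in vs0.
exists (fun x => nth y0 ws (index x vs)).
  exists (fun y => nth x0 vs (index y ws)) => [x|y].
    by rewrite index_uniq ?nth_index // -sz index_mem.
  by rewrite index_uniq ?nth_index // sz index_mem.
move=> x y; rewrite -(entry_mat (@adj H)) -?sz ?index_mem // -eq_mat.
by rewrite (entry_mat _ x0) ?index_mem // !nth_index.
Qed.

Definition presents (G : sgraph) (M : seq bitseq) : Prop :=
  exists vs : seq G,
    [/\ uniq vs, forall x, x \in vs & mat (@adj G) vs = M].

Lemma presents_iso (G H : sgraph) M :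
  isomorphic G H -> presents H M -> presents G M.
Proof.
case=> f [g fK gK] f_adj [ws [Uws wsT <-]].
exists (map g ws); split.
- by rewrite map_inj_uniq //; apply: can_inj gK.
- by move=> x; rewrite -(fK x) map_f.
- by rewrite /mat -map_comp; apply: eq_map => x /=; rewrite -map_comp;
    apply: eq_map => y /=; rewrite -f_adj !gK.
Qed.

(** A labelling is injective and as long as the vertex list of [H], so the vertices it picks exhaust
    [H]; listed in that order they have the code of [G]. *)
Lemma matches_isomorphic (G H : sgraph) (vs : seq G) M :
    vs != [::] -> uniq vs -> (forall x, x \in vs) -> presents H M ->
    matches (tri (@adj G) vs) M ->
  isomorphic G H.
Proof.
move=> vs0 Uvs vsT [ws [Uws wsT <-]] /andP[]; rewrite size_tri size_map => /eqP sz.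
have y0 : H by case: (ws) sz => [/size0nil vs_nil|//]; rewrite vs_nil in vs0.
case def_l: labellings => [//|f l] _.
have [Uf ltf eq_tri] : [/\ uniq f, {in f, forall i, i < size ws} &
    tri (@adj H) [seq nth y0 ws i | i <- f] = tri (@adj G) vs].
  by apply: labellings_sound; rewrite def_l inE eqxx.
have Ufs : uniq [seq nth y0 ws i | i <- f].
  by rewrite map_inj_in_uniq // => i j /ltf lti /ltf ltj /eqP;
     rewrite nth_uniq // => /eqP.
apply: (tri_isomorphic vs0 Uvs Ufs vsT) => [y|]; last by rewrite eq_tri.
have [||_ ->] := @uniq_min_size _ [seq nth y0 ws i | i <- f] ws Ufs.
- by move=> z _; rewrite wsT.
- by rewrite -sz -(size_tri (@adj G)) -eq_tri size_tri.
- by rewrite wsT.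
Qed.

(** * Short cycles *)

Section Cycles.
Variable G : sgraph.
Implicit Types (x y z w : G) (c p : seq G).
Local Notation e := (@adj G).

Definition simple_cycle c := [&& 2 < size c, uniq c & cycle e c].

Lemma simple_cycle_rot n c : simple_cycle (rot n c) = simple_cycle c.
Proof. by rewrite /simple_cycle size_rot rot_uniq rot_cycle. Qed.

(** The edge from [x] to [y] closes the initial segment of the path; [p != [::]] makes the length at
    least 3. *)
Lemma simple_cycle_chord x p y q :
    path e x (p ++ y :: q) -> uniq (x :: p ++ y :: q) -> p != [::] -> x -- y ->
  simple_cycle (x :: rcons p y).
Proof.
rewrite -cat_rcons cat_path -cat_cons cat_uniq => /andP[pp _] /andP[Up _] p0 xy.
apply/and3P; split=> //; first by case: (p) p0 => // ? ?; rewrite /= size_rcons.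
by rewrite /= rcons_path pp last_rcons adj_sym.
Qed.

(* All neighbours of an end of a longest path lie on that path. *)
Lemma ex_simple_cycle (x0 : G) :
  (forall x, 2 <= degree x) -> exists c, simple_cycle c.
Proof.
move=> deg2.
pose P n := [exists t : n.-tuple G, uniq t && sorted e t].
have exP : exists n, P n.
  by exists 1; apply/existsP; exists [tuple x0].
have leP n : P n -> n <= #|G|.
  by case/existsP=> t /andP[Ut _]; rewrite -(size_tuple t) -(card_uniqP Ut) max_card.
have [n /existsP[t /andP[Ut St]] maxn] := ex_maxnP exP leP.
have szt := size_tuple t; case: {t}(tval t) szt Ut St => [|x p] szt Ut St.
  have : P 1 by apply/existsP; exists [tuple x0].
  by move/maxn; rewrite -szt.
rewrite /= in St; have nbr y : x -- y -> y \in p.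
  move=> xy; apply/negPn/negP => yp.
  have: P n.+1.
    have sz : size (y :: x :: p) == n.+1 by rewrite /= -szt.
    apply/existsP; exists (Tuple sz) => /=.
    rewrite inE negb_or yp adj_sym xy St (Ut : (x \notin p) && uniq p) !andbT.
    by apply: contraTneq xy => ->; rewrite adj_irrefl.
  by move/maxn; rewrite ltnn.
have /card_gt1P[y [z [+ + neq_yz]]] := deg2 x; rewrite !inE => xy xz.
(* A neighbour other than the successor of [x] on the path, so that [p1] below is nonempty. *)
have [u [xu pu]] : exists u, x -- u /\ u != head x p.
  have [eqy|] := eqVneq y (head x p); last by exists y.
  by exists z; split=> //; rewrite -eqy eq_sym.
have /splitPr up := nbr u xu; case: up St Ut pu => p1 p2 St Ut pu.
exists (x :: rcons p1 u); apply: simple_cycle_chord St Ut _ xu.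
by case: (p1) pu => //=; rewrite eqxx.
Qed.

Lemma ex_shortest_cycle (x0 : G) : (forall x, 2 <= degree x) ->
  exists2 c, simple_cycle c & forall c', simple_cycle c' -> size c <= size c'.
Proof.
move=> /(ex_simple_cycle x0) [c0 c0_cyc].
pose P n := [exists t : n.-tuple G, simple_cycle t].
have cycP c : simple_cycle c -> P (size c).
  by move=> Cc; apply/existsP; exists (in_tuple c).
have exP : exists n, P n by exists (size c0); apply: cycP.
have [n /existsP[t Ct] minn] := ex_minnP exP.
by exists t => // c' /cycP/minn; rewrite size_tuple.
Qed.

(** Any neighbour of [x] on the cycle besides its successor and predecessor gives a chord, which
    cuts off a shorter cycle. *)
Lemma shortest_cycle_chord c i x y q : simple_cycle c ->
    (forall c', simple_cycle c' -> size c <= size c') ->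
    rot i c = x :: y :: q ->
  {in c, forall z, x -- z -> (z == y) || (z == last y q)}.
Proof.
move=> + c_min def_c z; rewrite -(simple_cycle_rot i) def_c.
rewrite -(mem_rot i) def_c -(size_rot i) def_c in c_min *.
case/and3P=> _ Uc cyc cz xz.
have /andP[pq _] : path e x (y :: q) && (last y q -- x).
  by rewrite -[last y q]/(last x (y :: q)) -rcons_path.
have [//|zy /=] := eqVneq z y.
apply/negPn/negP => zl.
have zq : z \in q.
  move: cz; rewrite !inE (negbTE zy) => /orP[/eqP zx|//].
  by rewrite zx adj_irrefl in xz.
case/splitPr: zq => q1 q2 in pq Uc c_min zl *.
(* The cycle closed by the chord omits exactly [q2], so minimality forces [q2] to be empty and [z]
   to be the last vertex. *)
have := c_min _ (@simple_cycle_chord x (y :: q1) z q2 pq Uc isT xz).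
rewrite /= size_rcons size_cat /= addnS !ltnS -{2}[size q1]addn0 leq_add2l.
by rewrite leqn0 => /nilP q2_nil; rewrite q2_nil last_cat /= eqxx in zl.
Qed.

(* The two arcs of [c] between [x] and [y], closed up through [w], are cycles of
   total length [size c + 4]. *)
Lemma shortest_cycle_outside c w x y : simple_cycle c ->
    (forall c', simple_cycle c' -> size c <= size c') ->
    w \notin c -> x \in c -> y \in c -> x != y -> w -- x -> w -- y ->
  size c <= 4.
Proof.
move=> + c_min wc xc yc neq_xy wx wy.
have [i p def_c] := rot_to xc; rewrite -(simple_cycle_rot i).
have {}wc : w \notin x :: p by rewrite -def_c mem_rot.
have yp : y \in p.
  by move: yc; rewrite -(mem_rot i) def_c inE eq_sym (negbTE neq_xy).
rewrite -(size_rot i) def_c in c_min *.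
case/splitPr: yp c_min wc {def_c} => p1 p2 c_min wc.
case/and3P=> _ Uc /=; rewrite rcons_cat cat_path /= => /and3P[p1_path p1y p2_path].
have c1 : simple_cycle (w :: x :: rcons p1 y).
  apply/and3P; split; first by rewrite /= size_rcons.
    move: wc Uc; rewrite -cat_rcons -cat_cons mem_cat cat_uniq negb_or.
    by case/andP=> wp1 _ /andP[Up1 _]; apply/andP.
  by rewrite /= wx !rcons_path p1_path p1y last_rcons adj_sym.
have c2 : simple_cycle (w :: y :: rcons p2 x).
  apply/and3P; split; first by rewrite /= size_rcons.
    (* Rotation past the first arc brings [y :: p2], followed by [x], to the front. *)
    have Uc2 : uniq (rot (size (x :: p1)) (x :: p1 ++ y :: p2)) by rewrite rot_uniq.
    have wc2 : w \notin rot (size (x :: p1)) (x :: p1 ++ y :: p2) by rewrite mem_rot.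
    move: Uc2 wc2; rewrite -cat_cons rot_size_cat -cat_rcons rcons_cons.
    rewrite mem_cat cat_uniq negb_or.
    by case/andP=> Up1 _ /andP[wp1 _]; apply/andP.
  by rewrite /= wy rcons_path p2_path last_rcons adj_sym.
(* Both lengths are at least [size c], whence [2 * size c <= size c + 4]. *)
have := leq_add (c_min _ c1) (c_min _ c2).
rewrite /= !size_rcons size_cat /= !addnS !addSn !ltnS.
by rewrite -addn2 leq_add2l.
Qed.

End Cycles.

(** The two neighbours are successor and predecessor, distinct since the cycle has at least three
    vertices. *)
Lemma simple_cycle_inner (G : sgraph) (c : seq G) : simple_cycle c -> inner c.
Proof.
move=> c_cyc; have /and3P[_ Uc _] := c_cyc; apply/allP => x xc.
rewrite count_adj //; have [i p def_c] := rot_to xc.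
have := c_cyc; rewrite -(simple_cycle_rot i) def_c => /and3P[].
have memc z : z \in p -> z \in c by move=> pz; rewrite -(mem_rot i) def_c inE pz orbT.
case: p memc {def_c} => [|y [|z q]] //= memc _ /and4P[_ yzq _ _].
rewrite rcons_path => /and3P[xy _ /andP[_ lx]].
apply/card_gt1P; exists y, (last z q); rewrite !inE !memc ?inE ?eqxx //=.
  split=> //; first by rewrite adj_sym.
  by apply: contraNneq yzq => ->; rewrite mem_last.
by have := mem_last z q; rewrite inE => ->; rewrite orbT.
Qed.

(** A vertex of degree at most 1 is by itself one side of a matching cut. *)
Lemma indecomposable_degree (G : sgraph) :
  ~ decomposable G -> 1 < #|G| -> forall x : G, 2 <= degree x.
Proof.
move=> indec G2 x; rewrite leqNgt; apply/negP => x1; apply: indec.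
apply/decomposableP; exists [set x]; split.
- by apply/set0Pn; exists x; rewrite inE.
- by apply: contraTneq G2 => xT; rewrite -cardsT -xT cards1.
move=> y; have [->|yx] := eqVneq y x.
  apply: leq_trans (x1 : degree x <= 1); apply/subset_leq_card/subsetP => z.
  by rewrite !inE => /andP[].
rewrite -(cards1 x); apply/subset_leq_card/subsetP => z.
by rewrite !inE (negbTE yx) => /andP[_]; case: (z == x).
Qed.

Lemma ex_short_cycle (G : sgraph) :
    subcubic G -> ~ decomposable G -> 1 < #|G| ->
  exists2 c : seq G, simple_cycle c & size c <= 4.
Proof.
move=> G3 indec G2; have deg2 := indecomposable_degree indec G2.
have /card_gt0P[x0 _] : 0 < #|G| by apply: ltnW.
have [c c_cyc c_min] := ex_shortest_cycle x0 deg2.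
exists c => //; rewrite leqNgt; apply/negP => c5.
have /and3P[_ Uc _] := c_cyc.
have [cN|cT] := boolP [exists x, x \notin c].
  have c0 : c != [::] by case: (c) c5.
  have [w wc] := inner_absorb G3 indec Uc c0 (simple_cycle_inner c_cyc) cN.
  rewrite count_adj // => /card_gt1P[x [y [+ + xy]]].
  rewrite !inE => /andP[xc wx] /andP[yc wy].
  have := shortest_cycle_outside c_cyc c_min wc xc yc xy wx wy.
  by rewrite leqNgt c5.
(* If [c] spans [G], then [x] and [y] both have degree 2, so absorbing into
   [{x, y}] produces a triangle. *)
have {cT} cT x : x \in c by move: cT; rewrite negb_exists => /forallP/(_ x)/negPn.
case: c => [|x [|y [|z q]]] // in c_cyc c_min c5 Uc cT *.
(* Rotations by 0 and 1 bring [x] and [y] to the head: [x] has only [y] and the last vertex as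
   neighbours, [y] only [z] and [x]. *)
have nx := @shortest_cycle_chord _ _ 0 x y (z :: q) c_cyc c_min (rot0 _).
have ny := @shortest_cycle_chord _ _ 1 y z (rcons q x) c_cyc c_min (rot1_cons _ _).
have [|||w] := @absorb _ [set x; y] indec.
- by apply/set0Pn; exists x; rewrite !inE eqxx.
- have /and3P[xz yz _] := Uc; apply/eqP => /setP/(_ z); rewrite !inE.
  case/orP=> /eqP eqz; [move: xz | move: yz]; by rewrite eqz !inE eqxx ?orbT.
- move=> u; rewrite !inE => /orP[] /eqP->; apply/card_le1_eqP => a b.
    rewrite !inE eqxx /=.
    case/andP=> xa aN /andP[xb bN].
    case/orP: (nx a (cT a) xa) (nx b (cT b) xb) => /eqP ea.
      by rewrite ea eqxx orbT in aN.
    case/orP=> /eqP eb; first by rewrite eb eqxx orbT in bN.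
    by rewrite ea eb.
  rewrite !inE eqxx orbT /=.
  case/andP=> ya aN /andP[yb bN].
  case/orP: (ny a (cT a) ya) (ny b (cT b) yb) => /eqP ea; last first.
    by rewrite last_rcons in ea; rewrite ea eqxx in aN.
  case/orP=> /eqP eb; last by rewrite last_rcons in eb; rewrite eb eqxx in bN.
  by rewrite ea eb.
rewrite !inE negb_or => /andP[wx wy] /card_gt1P[a [b [+ + ab]]]; rewrite !inE.
case/andP=> axy wa /andP[bxy wb].
have [adj_wx adj_wy] : w -- x /\ w -- y.
  by case/orP: axy ab wa => /eqP-> ab wa; case/orP: bxy ab wb => /eqP->; rewrite ?eqxx.
have /and3P[_ _ /= /andP[xy _]] := c_cyc.
have: simple_cycle [:: w; x; y].
  rewrite /simple_cycle /= !inE negb_or wx wy adj_wx xy adj_sym adj_wy !andbT.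
  by apply: contraTneq xy => ->; rewrite adj_irrefl.
by move/c_min; rewrite leqNgt ltnW.
Qed.

(** * The exceptional graphs *)

(** Turns the set comparison in [del_rel] into vertex comparisons, which can be evaluated on
    concrete graphs. *)
Lemma eq_set2 (T : finType) (x y a b : T) :
  ([set x; y] == [set a; b]) = (x == a) && (y == b) || (x == b) && (y == a).
Proof.
apply/eqP/idP => [eq_xy|/orP[]/andP[/eqP-> /eqP->]]; rewrite 1?setUC //.
have := set21 x y; have := set22 x y; rewrite eq_xy !inE.
have := set21 a b; have := set22 a b; rewrite -eq_xy !inE.
rewrite ![_ == x]eq_sym ![_ == y]eq_sym.
by case: (x == a) (x == b) (y == a) (y == b) => [] [] [] [].
Qed.

Lemma presents_card (G : sgraph) (vs : seq G) M :
  uniq vs -> size vs = #|G| -> mat (@adj G) vs = M -> presents G M.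
Proof.
move=> Uvs sz defM; exists vs; split=> // x.
have [|_ ->] := uniq_min_size Uvs (s2 := enum G) (fun y _ => mem_enum _ y).
  by rewrite sz cardE.
by rewrite mem_enum.
Qed.

Definition K33_seq : seq K33 :=
  [seq inl i | i <- [:: ord0; @Ordinal 3 1 isT; @Ordinal 3 2 isT]]
  ++ [seq inr i | i <- [:: ord0; @Ordinal 3 1 isT; @Ordinal 3 2 isT]].

Lemma presents_K3 : presents K3 (nth [::] exceptional_mats 0).
Proof.
by apply: (@presents_card K3 [:: ord0; @Ordinal 3 1 isT; @Ordinal 3 2 isT]);
  rewrite ?card_ord.
Qed.

Lemma presents_K4 : presents K4 (nth [::] exceptional_mats 1).
Proof. by apply: (@presents_card K4 [:: v0; v1; v2; v3]); rewrite ?card_ord. Qed.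

Lemma presents_K33 : presents K33 (nth [::] exceptional_mats 2).
Proof.
by apply: (@presents_card K33 K33_seq); rewrite ?card_sum ?card_ord.
Qed.

Lemma presents_K4_minus_edge :
  presents K4_minus_edge (nth [::] exceptional_mats 3).
Proof.
apply: (@presents_card K4_minus_edge [:: v0; v1; v2; v3]); rewrite ?card_ord //.
by rewrite /mat /= /del_rel !eq_set2.
Qed.

Lemma presents_K23 : presents K23 (nth [::] exceptional_mats 4).
Proof.
by apply: (@presents_card K23 [:: inl ord0; inl (@Ordinal 2 1 isT);
   inr ord0; inr (@Ordinal 3 1 isT); inr (@Ordinal 3 2 isT)]);
   rewrite ?card_sum ?card_ord.
Qed.

Lemma presents_K4_subdiv1 : presents K4_subdiv1 (nth [::] exceptional_mats 5).
Proof.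
apply: (@presents_card K4_subdiv1 [:: Some v0; Some v1; Some v2; Some v3; None]);
  rewrite ?card_option ?card_ord //.
by rewrite /mat /= /del_rel !eq_set2 !inE.
Qed.

Lemma presents_K4_subdiv2 : presents K4_subdiv2 (nth [::] exceptional_mats 6).
Proof.
apply: (@presents_card K4_subdiv2 [:: Some (Some v0); Some (Some v1);
    Some (Some v2); Some (Some v3); Some None; None]);
  rewrite ?card_option ?card_ord //.
by rewrite /mat /= /del_rel /= /del_rel !eq_set2 !inE.
Qed.

Lemma presents_K33_subdiv1 : presents K33_subdiv1 (nth [::] exceptional_mats 7).
Proof.
apply: (@presents_card K33_subdiv1 (rcons [seq Some x | x <- K33_seq] None));
  rewrite ?card_option ?card_sum ?card_ord //.
by rewrite /mat /= /del_rel !eq_set2 !inE.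
Qed.

(** Constructive: the cut is searched among the finitely many masks of an enumeration of [G]. *)
Lemma decomposable_dec (G : sgraph) : decomposable G \/ ~ decomposable G.
Proof.
have cutP := @has_cut_mat G (enum G) (enum_uniq _) (mem_enum _).
case: (boolP (has_cut (mat (@adj G) (enum G)))) => [/cutP|cutN]; first by left.
by right=> /cutP; apply/negP.
Qed.

Lemma exceptional_presents (G : sgraph) :
  exceptional G -> exists2 M, M \in exceptional_mats & presents G M.
Proof.
have ex i (H : sgraph) : i < 8 -> presents H (nth [::] exceptional_mats i) ->
    isomorphic G H -> exists2 M, M \in exceptional_mats & presents G M.
  move=> lti presH iso; exists (nth [::] exceptional_mats i).
    exact: mem_nth.
  exact: presents_iso presH.
case; first exact: ex presents_K3.
case; first exact: ex presents_K4.
case; first exact: ex presents_K33.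
case; first exact: ex presents_K4_minus_edge.
case; first exact: ex presents_K23.
case; first exact: ex presents_K4_subdiv1.
case; first exact: ex presents_K4_subdiv2.
exact: ex presents_K33_subdiv1.
Qed.

(** * From the finite search to the classification *)

Lemma matches_exceptional (G : sgraph) (vs : seq G) :
    vs != [::] -> uniq vs -> (forall x, x \in vs) ->
    has (matches (tri (@adj G) vs)) exceptional_mats ->
  exceptional G.
Proof.
move=> vs0 Uvs vsT /hasP[M /(nthP [::])[i lti <-]].
have iso H := @matches_isomorphic G H vs _ vs0 Uvs vsT.
rewrite /exceptional; do 8?[case: i lti => [|i] lti].
- by move/(iso _ _ presents_K3); tauto.
- by move/(iso _ _ presents_K4); tauto.
- by move/(iso _ _ presents_K33); tauto.
- by move/(iso _ _ presents_K4_minus_edge); tauto.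
- by move/(iso _ _ presents_K23); tauto.
- by move/(iso _ _ presents_K4_subdiv1); tauto.
- by move/(iso _ _ presents_K4_subdiv2); tauto.
- by move/(iso _ _ presents_K33_subdiv1); tauto.
by [].
Qed.

(** Induction on the search depth. If [vs] is all of [G], its code passed the test and has no cut,
    so it matches an exceptional graph. Otherwise absorption adds a vertex, and the new code is
    among the extensions checked. *)
Lemma closes_exceptional (G : sgraph) k (vs : seq G) :
    subcubic G -> ~ decomposable G -> uniq vs -> vs != [::] -> inner vs ->
    closes exceptional_mats k (tri (@adj G) vs) ->
  exceptional G.
Proof.
move=> G3 indec; elim: k vs => // k IHk vs Uvs vs0 Ivs /=.
have fullE us : full (tri (@adj G) us) = mat (@adj G) us.
  by apply: full_tri; [exact: adj_sym | exact: adj_irrefl].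
case/andP=> c_ok /allP ext_ok.
have [vsN|vsT] := boolP [exists x, x \notin vs].
  have [w wvs w2] := inner_absorb G3 indec Uvs vs0 Ivs vsN.
  have Uw : uniq (w :: vs) by rewrite /= wvs.
  apply: (IHk (w :: vs)) => //.
    rewrite /inner /= adj_irrefl add0n w2; apply/allP => x /(allP Ivs) x2.
    exact: leq_trans (leq_addl _ _).
  apply: ext_ok; apply: map_f; rewrite mem_filter mem_bitseqs.
  rewrite size_map size_tri eqxx andbT count_map w2.
  rewrite -[_ :: tri _ vs]/(tri (@adj G) (w :: vs)) fullE all_map.
  apply/allP => x _; rewrite -[X in is_true X]/(count id (map (adj x) (w :: vs)) <= 3).
  rewrite count_map; exact: count_adj_le.
have {}vsT x : x \in vs by move: vsT; rewrite negb_exists => /forallP/(_ x)/negPn.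
case/orP: c_ok => [|/matches_exceptional]; last exact.
by rewrite fullE => /(has_cut_mat Uvs vsT).
Qed.

(** The cycle fixes every entry except the two diagonals of a 4-cycle, whose values select one of
    four seeds. *)
Lemma cycle_code_seed (G : sgraph) (c : seq G) :
  simple_cycle c -> size c <= 4 -> tri (@adj G) c \in seeds.
Proof.
case: c => [|a [|b [|x [|y []]]]] //= /and3P[_ _ /=].
  by case/and4P=> -> -> xa _ _; rewrite adj_sym xa.
case/and5P=> -> -> -> ya _ _; rewrite (adj_sym a y) ya.
by case: (a -- x); case: (b -- y).
Qed.

Theorem theorem1 :
  (forall G : sgraph, connected G -> subcubic G -> 2 <= #|G| ->
     ~ exceptional G -> decomposable G) /\
  (forall H : sgraph, exceptional H -> ~ decomposable H).
Proof.
split=> [G _ G3 G2 Gex | H /exceptional_presents[M exM [vs [Uvs vsT defM]]]].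
  have [//|indec] := decomposable_dec G.
  have [c c_cyc c4] := ex_short_cycle G3 indec G2.
  have /and3P[c3 Uc _] := c_cyc.
  case: Gex; apply: (@closes_exceptional G 4 c) => //.
  - by case: (c) c3.
  - exact: simple_cycle_inner.
  - exact: (allP seeds_close) (cycle_code_seed c_cyc c4).
(* A cut of [H] would be a cut mask of its tabulated matrix. *)
move/(has_cut_mat Uvs vsT); rewrite defM => cutM.
by have /hasPn/(_ M exM)/negP := exceptional_mats_uncut.
Qed.
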